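(* Let $e\ge 1$ be an integer. If $p^2$ divides $e+1$ for some prime $p$, then for all integers $n,w$ with $1\le w\le n-1$ there is no nontrivial $e$-perfect code in the Johnson scheme $J(n,w)$.
   Context: The Johnson scheme $J(n,w)$ has as elements all $w$-subsets of $[n]=\{1,\dots,n\}$, with distance $d(X,Y)=|X\setminus Y|$. The $e$-ball centred at $X$ is the set of $w$-subsets at distance at most $e$ from $X$. An $e$-perfect code in $J(n,w)$ is a set $\mathcal C$ of $w$-subsets such that the $e$-balls centred at the elements of $\mathcal C$ partition the set of all $w$-subsets of $[n]$. It is trivial if $e=0$, or $|\mathcal C|=1$, or $n=2w$, $w=2e+1$ and $\mathcal C$ consists of a $w$-subset and its complement; otherwise it is nontrivial. *)

(* Defs.v *)
From mathcomp Require Import all_boot.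

Set Implicit Arguments.
Unset Strict Implicit.
Unset Printing Implicit Defensive.

(* The ground set {1, ..., n} is represented by 'I_n = {0, ..., n-1}. *)
Definition johnson (n w : nat) : {set {set 'I_n}} :=
  [set X : {set 'I_n} | #|X| == w].

Definition jdist (n : nat) (X Y : {set 'I_n}) : nat := #|X :\: Y|.

Definition jball (n w e : nat) (X : {set 'I_n}) : {set {set 'I_n}} :=
  [set Y in johnson n w | jdist X Y <= e].

(* The image set of balls identifies centres that have equal balls, so the
   injectivity clause is needed for the family of balls, indexed by the
   codewords, to be a partition: without it any nonempty C would qualify when
   e is at least the diameter of the scheme. *)
Definition perfect_code (n w e : nat) (C : {set {set 'I_n}}) : Prop :=
  [/\ C \subset johnson n w,
      partition [set jball w e X | X in C] (johnson n w)
    & {in C &, injective (jball w e)}].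

Definition trivial_code (n w e : nat) (C : {set {set 'I_n}}) : Prop :=
  [\/ e = 0,
      #|C| = 1
    | [/\ n = 2 * w, w = 2 * e + 1
        & exists2 X : {set 'I_n}, X \in johnson n w & C = [set X; ~: X]]].

(* Main.v *)
Require Import Defs.
From mathcomp Require Import all_boot all_order all_algebra zify ring.

(** Write [v = n - w] and let [Phi] be the size of an [e]-ball.  Take an
[e]-perfect code [C] that is not trivial; replacing its words by their
complements if necessary, [w <= v].  Two facts about [C] contradict each other
at a prime [p] with [p ^ 2 %| e.+1].

Local structure.  Fix a codeword [X].  The codewords [X'] at the minimum
distance [2e+1] from [X] are described by the pairs
[(A, B) = (X \ X', X' \ X)].  Because balls cover and do not overlap, every
pair [(I, J)] of [e+1]-subsets of [X] and of its complement lies in exactly one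
such [(A, B)], and two different such pairs satisfy
[|A /\ A'| + |B /\ B'| <= 2e+1]; this is a [pair_system].  Fixing [I] and [e]
points of the other side gives disjoint blocks, so that [e+1] divides [v - e]
and [e (v - e) <= (e+1) (w - e - 1)] ([pair_system_blocks]), and likewise with
[w] and [v] exchanged.  Hence [w] and [v] are [-1] modulo [p ^ 2], which forces
[p ^ 2 %| Phi] ([dvdn_ball_size]).  Looking one step further, at exchanges
leading to distance [e+2] from [X], gives with [al = w - 2e - 1] and
[be = v - 2e - 1] the inequality [e (e+1) (al + be) <= al * be]
([pair_system_ineq]).  Together these
give either [al = be = 0], the trivial code made of two complementary words, or
[al >= e (2e + 1)], so that [w] is quadratic in [e].

Design strength.  The function [Phi * 1_C - 1] is annihilated by the ball
kernel.  The eigenvalue of that kernel on the [j]-th layer of the scheme is an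
alternating sum whose terms decrease, by the inequalities just found, when
[0 < j] and [2 j < w]; so it is positive ([eigen_ball_gt0], [radius_bound]).  It
follows that [C] is a design of every strength [t < w / 2]
([kernel_design]): for [#|A| = t] the number of codewords containing [A] is
['C(n - t, v) / Phi], and therefore [Phi %| 'C(n - t, v)] ([tiling_design]).

Contradiction.  Choose [t] as the remainder of [w] modulo the largest power
[p ^ m <= w].  Then [n - t = c p ^ m + v] is below [p ^ m.+2], since [v] is less
than [3 w / 2], and Legendre's formula shows that [p ^ 2] does not divide
['C(n - t, v)] ([exists_bin_logn_le1]), although it divides [Phi]. *)

Set Implicit Arguments.
Unset Strict Implicit.
Unset Printing Implicit Defensive.

Import Order.TTheory GRing.Theory Num.Theory.

(** * Binomial coefficients modulo prime powers *)

Definition ball_size (e w v : nat) : nat :=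
  \sum_(i < e.+1) 'C(w, i) * 'C(v, i).

(** [(i+1) 'C(w+1, i+1) = (w+1) 'C(w, i)] is divisible by [p ^ 2], and [i+1] can
absorb only one factor [p]. *)
Lemma dvdn_binS p w i :
  prime p -> p ^ 2 %| w.+1 -> ~~ (p ^ 2 %| i.+1) -> p %| 'C(w.+1, i.+1).
Proof.
move=> p_pr pw pi.
have: p ^ 2 %| i.+1 * 'C(w.+1, i.+1) by rewrite -mul_bin_diag dvdn_mulr.
apply: contraLR => np.
by rewrite Gauss_dvdl // coprimeXl // prime_coprime.
Qed.

Lemma dvdn_binS_coprime q w i :
  q %| w.+1 -> coprime q i.+1 -> q %| 'C(w.+1, i.+1).
Proof. by move=> qw qi; rewrite -(Gauss_dvdr _ qi) -mul_bin_diag dvdn_mulr. Qed.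

(** The sign in ['C(w, i.+1) = - 'C(w, i)] modulo [q], which comes from Pascal's
rule, disappears in the product of two binomial coefficients. *)
Lemma bin_mul_step q w v i :
  q %| 'C(w.+1, i.+1) -> q %| 'C(v.+1, i.+1) ->
  'C(w, i.+1) * 'C(v, i.+1) = 'C(w, i) * 'C(v, i) %[mod q].
Proof.
rewrite !binS => /dvdnP[a Ha] /dvdnP[b Hb].
have E : ('C(w, i.+1) * b) * q + 'C(w, i) * 'C(v, i)
       = ('C(v, i) * a) * q + 'C(w, i.+1) * 'C(v, i.+1) by nia.
by rewrite -(modnMDl ('C(v, i) * a)) -E modnMDl.
Qed.

Lemma eq_mod_within_block (D : nat -> nat) q a n :
  (forall r, r.+1 < n -> D (a + r).+1 = D (a + r) %[mod q]) ->
  forall r, r < n -> D (a + r) = D a %[mod q].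
Proof.
move=> H; elim=> [|r IH] ltr; first by rewrite addn0.
by rewrite addnS H // IH // ltnW.
Qed.

Lemma sum_mod q n (F : nat -> nat) c :
  (forall r, r < n -> F r = c %[mod q]) -> \sum_(r < n) F r = n * c %[mod q].
Proof.
elim: n => [|n IH] H; first by rewrite big_ord0.
rewrite big_ord_recr /= mulSn addnC -modnDm IH ?H //; last by move=> r /ltnW; apply: H.
by rewrite modnDm.
Qed.

Lemma sum_blocks m n (F : nat -> nat) :
  \sum_(i < m * n) F i = \sum_(j < m) \sum_(r < n) F (j * n + r).
Proof.
elim: m => [|m IH]; first by rewrite mul0n !big_ord0.
rewrite big_ord_recr /= -IH -!(big_mkord xpredT) mulSn addnC.
rewrite (@big_cat_nat _ _ _ (m * n)) //= ?leq_addr //; congr (_ + _).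
rewrite -{1}[m * n]add0n big_addn addKn.
by rewrite -(big_mkord xpredT (fun r => F (m * n + r)));
  apply: eq_bigr => i _; rewrite addnC.
Qed.

(** The summands [D i = 'C(w, i) * 'C(v, i)] of the ball size are constant
modulo [p ^ 2] on each block of [p] consecutive indices, so the sum is [p *
\sum_j D (j * p)]; the numbers [D (j * p)] are in turn constant modulo [p]
on each block of [p] consecutive [j], which supplies the second factor [p]. *)
Lemma dvdn_ball_size p e w v : prime p ->
  p ^ 2 %| e.+1 -> p ^ 2 %| w.+1 -> p ^ 2 %| v.+1 -> p ^ 2 %| ball_size e w v.
Proof.
move=> p_pr pe pw pv; set D := fun i => 'C(w, i) * 'C(v, i).
have p_gt0 := prime_gt0 p_pr.
have stepq i : ~~ (p %| i.+1) -> D i.+1 = D i %[mod p ^ 2].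
  by move=> npi; apply: bin_mul_step; apply: dvdn_binS_coprime;
     rewrite // coprimeXl // prime_coprime.
have stepp i : ~~ (p ^ 2 %| i.+1) -> D i.+1 = D i %[mod p].
  by move=> npi; apply: bin_mul_step; apply: dvdn_binS.
have block j : \sum_(r < p) D (j * p + r) = p * D (j * p) %[mod p ^ 2].
  apply: (@sum_mod _ _ (fun r => D (j * p + r))).
  apply: eq_mod_within_block => r ltr; apply: stepq; rewrite -addnS (dvdn_addr _ (dvdn_mull j (dvdnn p))).
  by rewrite gtnNdvd.
have Dp k r : r < p -> D ((k * p + r) * p) = D (k * p ^ 2) %[mod p].
  move=> ltr; rewrite mulnDl -mulnA mulnn.
  apply: (@eq_mod_within_block _ _ _ (p ^ 2)). 2: by rewrite -mulnn ltn_pmul2r.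
  move=> s lts.
  apply: stepp; rewrite -addnS (dvdn_addr _ (dvdn_mull k (dvdnn _))).
  by rewrite gtnNdvd.
have [m Em] : exists m, e.+1 = m * p * p.
  by move/dvdnP: pe => [m ->]; exists m; rewrite -mulnA mulnn.
have -> : ball_size e w v = \sum_(j < m * p) \sum_(r < p) D (j * p + r).
  by rewrite -sum_blocks -Em.
have -> : (p ^ 2 %| \sum_(j < m * p) \sum_(r < p) D (j * p + r))
        = (p ^ 2 %| \sum_(j < m * p) p * D (j * p)).
  rewrite /dvdn; congr (_ == _).
  elim: (m * p) => [|k IH]; first by rewrite !big_ord0.
  by rewrite !big_ord_recr /= -modnDm IH block modnDm.
rewrite -big_distrr /= expnS expn1 dvdn_pmul2l // (sum_blocks m p (fun j => D (j * p))).
apply: (big_ind (fun x => p %| x)) => [|x y|k _]; [exact: dvdn0|exact: dvdn_add|].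
by rewrite /dvdn (@sum_mod _ _ (fun r => D ((k * p + r) * p)) (D (k * p ^ 2))) ?modnMr // => r; apply: Dp.
Qed.

(** In Legendre's formula for ['C(a + v, a)] with [a = c * p ^ m], the powers up
to [p ^ m] contribute nothing because they divide [a], those from [p ^ m.+2]
on exceed [a + v], and [p ^ m.+1] contributes at most one. *)
Lemma logn_bin_le1 p m c v : prime p -> 0 < c ->
  c * p ^ m + v < p ^ m.+2 -> logn p 'C(c * p ^ m + v, c * p ^ m) <= 1.
Proof.
move=> p_pr c_gt0; set a := c * p ^ m => lt_av.
have p_gt0 := prime_gt0 p_pr; have p_gt1 := prime_gt1 p_pr.
pose S n := \sum_(1 <= k < m.+2) n %/ p ^ k.
have lognS n : n <= a + v -> logn p n`! = S n.
  move=> le_n; rewrite logn_fact // /S.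
  pose N := n.+1 + m.+2.
  have widen b : b <= N -> (forall k, b <= k -> n %/ p ^ k = 0) -> 0 < b ->
     \sum_(1 <= k < b) n %/ p ^ k = \sum_(1 <= k < N) n %/ p ^ k.
    move=> leb H b_gt0; rewrite [RHS](@big_cat_nat _ _ _ b) //=.
    by rewrite [X in _ + X]big_nat_cond [X in _ + X]big1 ?addn0 // => k /andP[/andP[/H]].
  rewrite (widen n.+1) ?(widen m.+2) ?leq_addr ?leq_addl // => k lek.
  - by rewrite divn_small // (leq_ltn_trans le_n) // (leq_trans lt_av) // leq_pexp2l.
  - by rewrite divn_small // (ltn_trans _ (ltn_expl k p_gt1)).
have /(congr1 (logn p)) := bin_fact (leq_addr v a).
rewrite !lognM ?muln_gt0 ?fact_gt0 ?bin_gt0 ?leq_addr //.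
rewrite addKn !lognS ?leq_addr ?leq_addl //.
have S_recr n : S n = \sum_(1 <= k < m.+1) n %/ p ^ k + n %/ p ^ m.+1.
  by rewrite /S big_nat_recr.
rewrite !S_recr.
have -> : \sum_(1 <= k < m.+1) (a + v) %/ p ^ k
        = \sum_(1 <= k < m.+1) a %/ p ^ k + \sum_(1 <= k < m.+1) v %/ p ^ k.
  rewrite -big_split /=; apply: eq_big_nat => k /andP[_ lek].
  by rewrite divnDl // /a dvdn_mull // dvdn_exp2l.
have : (a + v) %/ p ^ m.+1 <= a %/ p ^ m.+1 + v %/ p ^ m.+1 + 1.
  by rewrite divnD ?expn_gt0 ?p_gt0 // leq_add2l leq_b1.
lia.
Qed.

(** Take [p ^ m <= w < p ^ m.+1] and remove from [w] its remainder modulo [p ^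
m], leaving [c * p ^ m]. The bound on [v] keeps [c * p ^ m + v] below [p ^
m.+2], so that [logn_bin_le1] applies; for [p = 2] this uses [c = 1]. *)
Lemma exists_bin_logn_le1 p w v : prime p -> 0 < w -> 2 * v < 3 * w ->
  exists i, [/\ 2 * i < w, i <= w & logn p 'C(w + v - i, v) <= 1].
Proof.
move=> p_pr w_gt0 lt_v; have p_gt1 := prime_gt1 p_pr.
set m := trunc_log p w; have le_pm : p ^ m <= w := trunc_logP p_gt1 w_gt0.
have lt_w : w < p ^ m.+1 := trunc_log_ltn w p_gt1.
have pm_gt0 : 0 < p ^ m by rewrite expn_gt0 prime_gt0.
have c_gt0 : 0 < w %/ p ^ m by rewrite divn_gt0.
have Ew := divn_eq w (p ^ m).
have lt_i := ltn_pmod w pm_gt0.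
exists (w %% p ^ m); set c := w %/ p ^ m in c_gt0 Ew *; set i := w %% p ^ m in lt_i Ew *.
have le_c : p ^ m <= c * p ^ m by rewrite leq_pmull.
split; [lia|lia|].
have -> : w + v - i = c * p ^ m + v by lia.
rewrite -{2}(addKn (c * p ^ m) v) bin_sub ?leq_addr //.
apply: logn_bin_le1 => //.
case: (ltngtP p 2) => [|p_gt2|p2]; first by lia.
  have : 3 * p ^ m.+1 <= p ^ m.+2 by rewrite [p ^ m.+2]expnS leq_mul2r p_gt2 orbT.
  lia.
rewrite p2 !expnS in le_pm lt_w Ew le_c pm_gt0 *.
have : c < 2 by rewrite -(ltn_pmul2r pm_gt0); lia.
move: c_gt0 Ew; case: c {le_c} => [|[|]] // _ _ _; lia.
Qed.

(** * Numerical inequalities *)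

(** The hypotheses are those obtained from the local structure of a perfect
code, with [al = w - 2e - 1] and [be = v - 2e - 1]; the last conclusion is
what makes the terms of the eigenvalue of index [j.+1] decrease. The
hypotheses give [al >= e (2e + 1)], and [2 be - al >= 2 e (e + 1)] since
[al] and [be] cannot both be below [2 e (e + 1)]. As [2 (j + 1) <= al + 2e],
twice the first factor on the right is at least [al + 4] and the second one
at least [e (e + 1) + 2]. *)
Lemma radius_bound e al be j :
  0 < al -> al <= be -> e * be <= e.+1 * al ->
  e.+1 * e * (al + be) <= al * be -> 2 * j.+1 <= al + 2 * e ->
  let w := al + e.*2.+1 in let v := be + e.*2.+1 in
  [/\ e <= w - j.+1, e <= v - j.+1
    & j * e ^ 2 < (w - j.+1 - e).+1 * (v - j.+1 - e).+1].
Proof.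
move=> al_gt0 le_ab ratio harm le_j w v.
have al_ge : e * (e.*2.+1) <= al.
  rewrite -(leq_pmul2r (leq_trans al_gt0 le_ab)); apply: leq_trans harm; nia.
have be_ge : al + 2 * (e * e.+1) <= 2 * be.
  case: (leqP (2 * (e * e.+1)) al) => [|lt]; first by lia.
  suff : 2 * (e * e.+1) <= be by lia.
  rewrite leqNgt; apply/negP => lt'; nia.
split; [rewrite /w; lia|rewrite /v; lia|].
set K := (w - _ - _).+1; set L := (v - _ - _).+1.
have HK : al + 4 <= 2 * K by rewrite /K /w; lia.
have HL : e * e.+1 + 2 <= L by rewrite /L /v; lia.
have : (al + 4) * (e * e.+1 + 2) <= 2 * (K * L) by rewrite mulnA leq_mul.
have : 2 * (j * e ^ 2) <= (al + 2 * e - 2) * e ^ 2 by rewrite mulnA leq_mul2r; lia.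
have : (e * e.*2.+1) * e.+2 <= al * e.+2 by rewrite leq_mul2r al_ge orbT.
move: (K * L) (j * e ^ 2) => x y; rewrite -mulnn.
case: e {ratio harm le_j w v be_ge K L HK HL al_ge} => [|e]; nia.
Qed.

Lemma subn_half_leq d e : d <= e.*2 -> d - d./2 <= e.
Proof. lia. Qed.

Lemma half_leq_self d : d./2 <= d.
Proof. lia. Qed.

Lemma block_ratio e s al be :
  be + e.*2.+1 = e + s * e.+1 -> s * e + e.+1 <= al + e.*2.+1 ->
  e * be <= e.+1 * al.
Proof. nia. Qed.

Lemma lt_ratio e al be : 3 <= e -> e * be <= e.+1 * al -> 0 < al ->
  2 * (be + e.*2.+1) < 3 * (al + e.*2.+1).
Proof. nia. Qed.

Lemma double_index_bound i j al e :
  j < i -> 2 * i < al + e.*2.+1 -> 2 * j.+1 <= al + 2 * e.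
Proof. lia. Qed.

Lemma double_ltn e : e.*2.+1 < e.+1 + e.+1.
Proof. by rewrite addSn addnS addnn. Qed.

Lemma double_subn e : e.*2.+1 - e.+1 = e.
Proof. by rewrite subSS -addnn addnK. Qed.

(** * Kernels on subsets depending on the distance *)

(** A set [Z] of the sphere corresponds to what it loses from [X] and what it
gains outside [X]. *)
Lemma card_sphere (T : finType) (G X : {set T}) k u r :
  X \subset G -> #|X| = k -> #|G| = k + u ->
  #|[set Z : {set T} | [&& Z \subset G, #|Z| == k & #|X :\: Z| == r]]|
  = 'C(k, r) * 'C(u, r).
Proof.
move=> sXG cX cG.
pose f (PQ : {set T} * {set T}) := (X :\: PQ.1) :|: PQ.2.
pose A1 := [set P : {set T} | P \subset X & #|P| == r].
pose A2 := [set Q : {set T} | Q \subset G :\: X & #|Q| == r].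
have fK (P Q : {set T}) : P \subset X -> Q \subset G :\: X ->
    X :\: f (P, Q) = P /\ f (P, Q) :\: X = Q.
  move=> /subsetP sP /subsetP sQ; split; apply/setP => x; rewrite !inE /=.
    have /implyP := sP x; have /implyP := sQ x; rewrite !inE.
    by case: (x \in P); case: (x \in Q); case: (x \in X).
  have /implyP := sP x; have /implyP := sQ x; rewrite !inE.
  by case: (x \in P); case: (x \in Q); case: (x \in X).
have cardX (Z : {set T}) : #|Z| + #|X :\: Z| = k + #|Z :\: X|.
  by rewrite -cX -(cardsID X Z) -(cardsID Z X) setIC; lia.
have -> : [set Z : {set T} | [&& Z \subset G, #|Z| == k & #|X :\: Z| == r]]
        = f @: setX A1 A2.
  apply/setP => Z; apply/idP/imsetP.
    rewrite inE => /and3P[sZ /eqP cZ /eqP cXZ].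
    exists (X :\: Z, Z :\: X).
      rewrite in_setX !inE /= subsetDl cXZ eqxx setSD //=.
      by move: (cardX Z); rewrite cZ cXZ => /addnI <-.
    by rewrite /f /=; apply/setP => x; rewrite !inE; case: (x \in X); case: (x \in Z).
  case=> [[P Q]] /setXP[/=]; rewrite !inE => /andP[sP /eqP cP] /andP[sQ /eqP cQ] ->.
  have [E1 E2] := fK _ _ sP sQ.
  rewrite E1 cP eqxx andbT; apply/andP; split.
    rewrite subUset (subset_trans (subsetDl _ _)) //=.
    by rewrite (subset_trans sQ) // subsetDl.
  by apply/eqP; move: (cardX (f (P, Q))); rewrite E1 E2 cP cQ => /addIn.
rewrite card_in_imset.
  rewrite cardsX !cards_draws cX cardsD (setIidPr sXG) cG cX.
  by congr (_ * 'C(_, _)); lia.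
move=> [P Q] [P' Q']; rewrite !in_setX /= !inE.
move=> /andP[/andP[sP _] /andP[sQ _]] /andP[/andP[sP' _] /andP[sQ' _]] E.
have [E1 E2] := fK _ _ sP sQ; have [E3 E4] := fK _ _ sP' sQ'.
by congr (_, _); [rewrite -E1 E E3|rewrite -E2 E E4].
Qed.

Local Open Scope ring_scope.

Lemma sum_kernel (T : finType) (G X : {set T}) k u (K : nat -> int) :
  X \subset G -> #|X| = k -> #|G| = (k + u)%N ->
  \sum_(Z : {set T} | (Z \subset G) && (#|Z| == k)) K #|X :\: Z|
  = \sum_(r < k.+1) K r * ('C(k, r) * 'C(u, r))%N%:R.
Proof.
move=> sXG cX cG.
rewrite (partition_big (fun Z : {set T} => inord #|X :\: Z| : 'I_k.+1) xpredT) //=.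
apply: eq_bigr => r _.
rewrite (eq_bigr (fun _ => K r)); last first.
  move=> Z /andP[_ /eqP <-]; rewrite inordK // ltnS -cX.
  by rewrite subset_leq_card // subsetDl.
rewrite sumr_const mulr_natr; congr (_ *+ _).
rewrite -(card_sphere r sXG cX cG) cardsE; apply: eq_card => Z.
rewrite !unfold_in -andbA /=; congr [&& _, _ & _].
rewrite -val_eqE /= inordK // ltnS -cX.
by rewrite subset_leq_card // subsetDl.
Qed.

Section Kernel.
Variable T : finType.
Implicit Types (G A X Z : {set T}) (g : {set T} -> int) (K : nat -> int).

(** The kernel that the distance kernel [K] induces on the sets from which a
pair of points has been split off, see [kernel_swap]. *)
Definition nabla K m := K m - K m.+1.

(** The common row sum of the kernel [K] on [k]-subsets of a [(k + u)]-set: its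
eigenvalue on constant functions. *)
Definition eigen K k u : int := \sum_(r < k.+1) K r * ('C(k, r) * 'C(u, r))%N%:R.

(** The effect of exchanging [a] and [b] is always a sum of this kind: sets that
treat both points alike cancel. *)
Lemma sum_one_of_two (a b : T) G k (h : {set T} -> int) :
  a != b -> a \in G -> b \in G ->
  (forall X, a \in X -> b \in X -> h X = 0) ->
  (forall X, a \notin X -> b \notin X -> h X = 0) ->
  \sum_(X : {set T} | (X \subset G) && (#|X| == k.+1)) h X
  = \sum_(X : {set T} | (X \subset G :\ a :\ b) && (#|X| == k)) (h (a |: X) + h (b |: X)).
Proof.
move=> neq_ab aG bG hboth hnone.
have half (c d : T) : c != d -> c \in G -> d \in G ->
    \sum_(X : {set T} | [&& X \subset G, #|X| == k.+1, c \in X & d \notin X]) h X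
    = \sum_(X : {set T} | (X \subset G :\ c :\ d) && (#|X| == k)) h (c |: X).
  move=> neq_cd cG dG.
  rewrite (reindex_onto (fun X => c |: X) (fun X => X :\ c)) /=; last first.
    by move=> X /and4P[_ _ cX _]; rewrite setD1K.
  apply: eq_bigl => X; rewrite !subsetD1 subUset sub1set cG /=.
  rewrite setU11 !inE [d == c]eq_sym (negPf neq_cd) /=.
  have -> : ((c |: X) :\ c == X) = (c \notin X).
    apply/eqP/idP => [<-|cX]; first by rewrite !inE eqxx.
    by rewrite setU1K.
  rewrite cardsU1; case: (boolP (c \in X)) => cX /=; last first.
    by rewrite add1n eqSS andbT; case: (X \subset G); case: (d \notin X); rewrite /= ?andbT ?andbF.
  by rewrite !andbF.
rewrite big_split /= -(half a b) // [X in _ + X](eq_bigl (fun X => (X \subset G :\ b :\ a) && (#|X| == k))); last first.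
  by move=> X; rewrite !setDDl setUC.
rewrite -(half b a) 1?eq_sym //.
rewrite (bigID (fun X : {set T} => a \in X)) /=; congr (_ + _).
  rewrite (bigID (fun X : {set T} => b \in X)) /= big1 ?add0r => [|X]; last first.
    by case/andP=> /andP[_ aX] bX; apply: hboth.
  by apply: eq_bigl => X; rewrite -!andbA.
rewrite (bigID (fun X : {set T} => b \in X)) /= [X in _ + X]big1 ?addr0 => [|X]; last first.
  by case/andP=> /andP[_ aX] bX; apply: hnone.
by apply: eq_bigl => X; rewrite -!andbA; case: (a \in X); case: (b \in X).
Qed.

(** The function [X |-> g (a |: X) - g (b |: X)] intertwines the kernels [K] and
[nabla K]. Sets containing both or none of [a], [b] are equally far from [a
|: Z] and [b |: Z] and cancel; for the others, exchanging [a] and [b]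
changes the distance by one. *)
Lemma kernel_swap K G k g (a b : T) Z :
  a != b -> a \in G -> b \in G -> Z \subset G :\ a :\ b ->
  \sum_(X : {set T} | (X \subset G :\ a :\ b) && (#|X| == k))
     nabla K #|X :\: Z| * (g (a |: X) - g (b |: X))
  = \sum_(X : {set T} | (X \subset G) && (#|X| == k.+1)) K #|X :\: (a |: Z)| * g X
  - \sum_(X : {set T} | (X \subset G) && (#|X| == k.+1)) K #|X :\: (b |: Z)| * g X.
Proof.
move=> neq_ab aG bG; rewrite !subsetD1 => /andP[/andP[sZ aZ] bZ].
rewrite -sumrB.
rewrite (@sum_one_of_two a b) //; last 2 first.
- move=> X aX bX; rewrite -mulrBl.
  suff -> : #|X :\: (a |: Z)| = #|X :\: (b |: Z)| by rewrite subrr mul0r.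
  have E c : c \notin Z -> c \in X -> #|X :\: Z| = #|X :\: (c |: Z)|.+1.
    by move=> cZ cX; rewrite (cardsD1 c) !inE cZ cX setDDl setUC.
  by apply: succn_inj; rewrite -!E.
- move=> X aX bX; rewrite -mulrBl.
  suff E c : c \notin X -> X :\: (c |: Z) = X :\: Z by rewrite !E // subrr mul0r.
  by move=> cX; rewrite setDUr (setDidPl _) ?disjoints1 // 1?disjoint_sym ?disjoints1 // (setIidPr (subsetDl _ _)).
apply: eq_bigr => X; rewrite !subsetD1 => /andP[/andP[/andP[sX aX] bX] _].
have E1 c : c \notin X -> c \notin Z -> (c |: X) :\: (c |: Z) = X :\: Z.
  move=> cX cZ; apply/setP => x; rewrite !inE; case: (altP (x =P c)) => //= ->.
  by rewrite (negPf cX) andbF.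
have E2 c d : c != d -> c \notin X -> c \notin Z -> d \notin X -> #|(c |: X) :\: (d |: Z)| = #|X :\: Z|.+1.
  move=> cd cX cZ dX; rewrite (cardsD1 c) !inE (negPf cd) (negPf cZ) eqxx /= add1n; congr _.+1.
  apply: eq_card => x; rewrite !inE.
  case: (altP (x =P c)) => /= [->|_]; first by rewrite (negPf cX) andbF.
  by case: (altP (x =P d)) => //= ->; rewrite (negPf dX) andbF.
by rewrite !E1 // !E2 // 1?eq_sym // /nabla; ring.
Qed.

Definition containing g G k A :=
  \sum_(X : {set T} | (X \subset G) && (#|X| == k)) g X *+ (A \subset X).

Lemma containing_swap g G k A (a b : T) :
  a != b -> a \in G -> b \in G -> a \notin A -> b \notin A ->
  containing (fun X => g (a |: X) - g (b |: X)) (G :\ a :\ b) k A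
  = containing g G k.+1 (a |: A) - containing g G k.+1 (b |: A).
Proof.
move=> neq_ab aG bG aA bA; rewrite /containing -sumrB.
rewrite (@sum_one_of_two a b) //; last 2 first.
- by move=> X aX bX; rewrite !subUset !sub1set aX bX subrr.
- by move=> X aX bX; rewrite !subUset !sub1set (negPf aX) (negPf bX) subrr.
apply: eq_bigr => X; rewrite !subsetD1 => /andP[/andP[/andP[sX aX] bX] _].
have E c : c \notin A -> (A \subset c |: X) = (A \subset X).
  by move=> cA; rewrite -subDset (setDidPl _) // disjoint_sym disjoints1.
rewrite !subUset !sub1set !inE !eqxx (negPf neq_ab) eq_sym (negPf neq_ab) (negPf aX) (negPf bX) /=.
by rewrite !E // mulrnBl subr0 sub0r.
Qed.

Lemma sum_containing g G k A : A \subset G -> (#|A| <= k)%N ->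
  \sum_(b in G :\: A) containing g G k (b |: A) = containing g G k A *+ (k - #|A|)%N.
Proof.
move=> sAG leA; rewrite /containing exchange_big /= -sumrMnl.
apply: eq_bigr => X /andP[sX /eqP cX].
case: (boolP (A \subset X)) => sAX; last first.
  by rewrite mul0rn big1 // => b _; rewrite subUset (negPf sAX) andbF.
have -> : (k - #|A| = #|X :\: A|)%N by rewrite cardsD (setIidPr sAX) cX.
rewrite mulr1n -sumr_const.
rewrite [RHS]big_mkcond [LHS]big_mkcond /=; apply: eq_bigr => b _.
rewrite subUset sub1set sAX andbT !inE.
case: (boolP (b \in X)) => bX /=; last by rewrite andbF; case: ifP.
by rewrite (subsetP sX) // andbT.
Qed.

(** Delsarte's argument that a design can only fail on the layers where the
eigenvalue vanishes, carried out by splitting off one pair of points at a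
time. If [#|A| = 0], the claim is that the total sum of [g] vanishes, which
follows on summing the kernel equation over [Z], since the row sum is
nonzero. For [A = a |: A0] and any [b] outside [A0], [kernel_swap] and the
induction hypothesis for [nabla K] and [A0] show that the sums over the
supersets of [a |: A0] and [b |: A0] agree; averaging over [b] then reduces
[A] to [A0]. The eigenvalues met along the way are those of the iterates of
[nabla], one for each layer of the scheme. *)
Lemma kernel_design t : forall K G k u g,
  #|G| = (k + u)%N -> (t <= k)%N -> (t <= u)%N ->
  (forall Z, Z \subset G -> #|Z| = k ->
     \sum_(X : {set T} | (X \subset G) && (#|X| == k)) K #|X :\: Z| * g X = 0) ->
  (forall j, (j <= t)%N -> eigen (iter j nabla K) (k - j) (u - j) != 0) ->
  forall A, A \subset G -> (#|A| <= t)%N -> containing g G k A = 0.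
Proof.
elim: t => [|t IH] K G k u g cG ltk ltu HK Heig A sAG.
  rewrite leqn0 cards_eq0 => /eqP->; rewrite /containing.
  have /eqP := Heig 0 isT; rewrite !subn0 /= => Hne.
  suff /eqP : eigen K k u * \sum_(X : {set T} | (X \subset G) && (#|X| == k)) g X = 0.
    rewrite mulf_eq0 => /orP[/eqP//|/eqP E]; rewrite -[RHS]E.
    by apply: eq_bigr => X _; rewrite sub0set.
  rewrite big_distrr /=.
  transitivity (\sum_(X : {set T} | (X \subset G) && (#|X| == k))
                \sum_(Z : {set T} | (Z \subset G) && (#|Z| == k)) K #|X :\: Z| * g X).
    apply: eq_bigr => X /andP[sX /eqP cX].
    by rewrite -big_distrl /= (sum_kernel K sX cX cG).
  by rewrite exchange_big big1 //= => Z /andP[sZ /eqP cZ]; apply: HK.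
rewrite leq_eqVlt => /orP[/eqP cA|]; last first.
  rewrite ltnS; apply: (IH K G k u) => //; [exact: ltnW|exact: ltnW|].
  by move=> j lej; apply: Heig; apply: leqW.
have /set0Pn[a aA] : A != set0 by rewrite -card_gt0 cA.
case: k => // k in cG ltk HK Heig *; case: u => // u in cG ltu HK Heig *.
set A0 := A :\ a; have aA0 : a \notin A0 by rewrite !inE eqxx.
have cA0 : #|A0| = t by move: cA; rewrite (cardsD1 a) aA => -[].
have sA0 : A0 \subset G := subset_trans (subsetDl _ _) sAG.
have aG := subsetP sAG a aA.
have -> : A = a |: A0 by rewrite setD1K.
have Eswap b : b \in G :\: A0 -> containing g G k.+1 (b |: A0) = containing g G k.+1 (a |: A0).
  rewrite inE => /andP[bA0 bG].
  case: (altP (a =P b)) => [->//|neq_ab].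
  apply/esym/eqP; rewrite -subr_eq0 -containing_swap //; apply/eqP.
  apply: (IH (nabla K) _ k u); rewrite ?cA0 //.
  - move: cG; rewrite (cardsD1 a) aG (cardsD1 b) !inE eq_sym neq_ab bG /=; lia.
  - move=> Z sZ cZ; rewrite (@kernel_swap K) //.
    move: (sZ); rewrite !subsetD1 => /andP[/andP[sZG aZ] bZ].
    by rewrite !HK ?subrr // ?subUset ?sub1set ?aG ?bG // cardsU1 ?aZ ?bZ cZ.
  - by move=> j lej; rewrite -iterSr -(subSS j k) -(subSS j u); apply: Heig.
  - by rewrite !subsetD1 sA0 aA0 bA0.
have := @sum_containing g G k.+1 A0 sA0; rewrite cA0 => /(_ (ltnW ltk)).
have -> : containing g G k.+1 A0 = 0.
  apply: (IH K G k.+1 u.+1); rewrite ?cA0 //; [exact: ltnW|exact: ltnW|].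
  by move=> j lej; apply: Heig; apply: leqW.
rewrite mul0rn (eq_bigr _ Eswap) sumr_const => /eqP.
rewrite mulrn_eq0 cards_eq0 => /orP[/eqP E|/eqP //].
by move: (in_set0 a); rewrite -E inE aA0 aG.
Qed.

End Kernel.

(** * Eigenvalues of the ball kernel *)

Definition ball_kernel (e m : nat) : int := (m <= e)%N%:R.

(** One step turns the ball of radius [e] into the sphere of radius [e]; every
further step is a difference, and Pascal's rule collects the signs. *)
Lemma iter_nabla_ball j e r :
  iter j.+1 nabla (ball_kernel e) r
  = if (r <= e)%N then (-1) ^+ (e - r) * 'C(j, e - r)%:R else 0.
Proof.
elim: j r => [|j IH] r.
  rewrite /= /nabla /ball_kernel; case: (ltngtP r e) => [ltr|gtr|->].
  - by rewrite subrr -(subnSK ltr) bin0n /= mulr0.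
  - by rewrite subrr.
  - by rewrite subnn bin0 expr0 mulr1 subr0.
rewrite iterS /nabla !IH.
case: (ltngtP r e) => [ltr|gtr|->]; last 2 first.
- by rewrite subr0.
- by rewrite subnn !bin0 subr0.
by rewrite -(subnSK ltr) binS exprS natrD; ring.
Qed.

Lemma eigen_ball0 e w v : (e <= w)%N ->
  eigen (ball_kernel e) w v = (ball_size e w v)%:R.
Proof.
move=> lew; rewrite /eigen /ball_size natr_sum.
rewrite (big_ord_widen_cond w.+1 xpredT (fun i => ('C(w, i) * 'C(v, i))%N%:R)) //=.
rewrite [RHS]big_mkcond /=; apply: eq_bigr => i _.
by rewrite /ball_kernel ltnS; case: (i <= e)%N; rewrite ?mul1r ?mul0r.
Qed.

Lemma alternating_sum_bounds (F : nat -> int) m :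
  (forall i, 0 <= F i) -> (forall i, F i.+1 <= F i) ->
  0 <= \sum_(i < m) (-1) ^+ i * F i <= F 0%N.
Proof.
elim: m F => [|m IH] F F0 Fd; first by rewrite big_ord0 lexx F0.
rewrite big_ord_recl expr0 mul1r /=.
rewrite (eq_bigr (fun i : 'I_m => - ((-1) ^+ i * F i.+1))); last first.
  by move=> i _; rewrite /bump /= add1n exprS; ring.
rewrite sumrN; have /andP[H1 H2] := IH (F \o S) (fun i => F0 _) (fun i => Fd _).
by rewrite subr_ge0 gerBl (le_trans H2 (Fd 0%N)).
Qed.

(** With [F i = 'C(q, i) * 'C(k, e - i) * 'C(u, e - i)] the eigenvalue is
[\sum_i (-1) ^+ i * F i] (an Eberlein polynomial). The ratio of consecutive
terms is largest at the start, where it is at most [q * e ^ 2 / ((k - e).+1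
* (u - e).+1) < 1], so the sum has the sign of its first term. *)
Lemma eigen_ball_gt0 q e k u : (e <= k)%N -> (e <= u)%N ->
  (q * e ^ 2 < (k - e).+1 * (u - e).+1)%N ->
  0 < eigen (iter q.+1 nabla (ball_kernel e)) k u.
Proof.
move=> lek leu Hq.
pose F i : nat := if (i <= e)%N then ('C(q, i) * 'C(k, e - i) * 'C(u, e - i))%N else 0%N.
have Fstep i : (F i.+1 <= F i)%N && ((0 < F i) ==> (F i.+1 < F i))%N.
  rewrite /F; case: (ltnP i e) => [lti|gei]; last by case: ifP; case: (_ * _)%N.
  rewrite (ltnW lti).
  have E1 : (i.+1 * 'C(q, i.+1) = (q - i) * 'C(q, i))%N by rewrite mul_bin_left.
  have E2 m : (e <= m)%N -> ((e - i) * 'C(m, e - i) = (m - (e - i.+1)) * 'C(m, e - i.+1))%N.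
    by move=> lem; rewrite -(subnSK lti) mul_bin_left.
  have := E2 _ lek; have := E2 _ leu.
  set a := 'C(q, i.+1) in E1 *; set a' := 'C(q, i) in E1 *.
  set b := 'C(k, e - i.+1); set b' := 'C(k, e - i).
  set c := 'C(u, e - i.+1); set c' := 'C(u, e - i) => Ec Eb.
  set P := (i.+1 * ((k - (e - i.+1)) * (u - (e - i.+1))))%N.
  set Q := ((q - i) * ((e - i) * (e - i)))%N.
  have E : (P * (a * b * c) = Q * (a' * b' * c'))%N.
    transitivity ((i.+1 * a) * ((k - (e - i.+1)) * b) * ((u - (e - i.+1)) * c))%N.
      by rewrite /P; ring.
    by rewrite E1 -Eb -Ec /Q; ring.
  have ltQP : (Q < P)%N.
    apply: (@leq_ltn_trans (q * e ^ 2)).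
      by rewrite /Q -mulnn leq_mul ?leq_subr // leq_mul ?leq_subr.
    apply: (leq_trans Hq); rewrite /P -[X in (X <= _)%N]mul1n leq_mul // leq_mul; lia.
  case: (posnP (a' * b' * c')) => [E0|gt0].
    by move/eqP: E; rewrite E0 muln0 muln_eq0 => /orP[/eqP P0|/eqP->//]; move: ltQP; rewrite P0.
  have lt : (a * b * c < a' * b' * c')%N.
    rewrite -(ltn_pmul2l (leq_ltn_trans (leq0n Q) ltQP)) E ltn_pmul2r //.
  by rewrite lt (ltnW lt).
have -> : eigen (iter q.+1 nabla (ball_kernel e)) k u = \sum_(i < e.+1) (-1) ^+ i * (F i)%:R.
  rewrite /eigen; under eq_bigr => i _ do rewrite iter_nabla_ball.
  rewrite [RHS](reindex_inj rev_ord_inj) /=.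
  rewrite (big_ord_widen_cond k.+1 xpredT
     (fun i => (-1) ^+ (e.+1 - i.+1) * (F (e.+1 - i.+1)%N)%:R)) //=.
  rewrite [RHS]big_mkcond /=; apply: eq_bigr => i _.
  rewrite ltnS subSS; case: (leqP i e) => lei; last by rewrite mul0r.
  by rewrite /F leq_subr subKn // -mulrA -natrM mulnA.
rewrite big_ord_recl expr0 mul1r /=.
rewrite (eq_bigr (fun i : 'I_e => - ((-1) ^+ i * (F i.+1)%:R))); last first.
  by move=> i _; rewrite /bump /= add1n exprS; ring.
rewrite sumrN subr_gt0.
have Fdec i : ((F i.+2)%:R <= (F i.+1)%:R :> int).
  by rewrite ler_nat; case/andP: (Fstep i.+1).
have /andP[_ H] := @alternating_sum_bounds (fun i => (F i.+1)%:R) e (fun i => ler0n _ _) Fdec.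
apply: (le_lt_trans H); rewrite ltr_nat.
have /andP[_ /implyP] := Fstep 0%N; apply.
by rewrite /F /= bin0 subn0 mul1n muln_gt0 !bin_gt0 lek leu.
Qed.

Local Close Scope ring_scope.

(** * Pair systems *)

(** Disjointness is only required in the form that a point determines the index,
so that empty members may repeat. *)
Lemma sum_card_disjoint (I T : finType) (S : {set I}) (F : I -> {set T}) (D : {set T}) :
  (forall i, i \in S -> F i \subset D) ->
  (forall i j x, i \in S -> j \in S -> x \in F i -> x \in F j -> i = j) ->
  \sum_(i in S) #|F i| <= #|D|.
Proof.
move=> sFD disjF.
under eq_bigr => i _ do rewrite -sum1_card.
rewrite (exchange_big_dep (mem D)) /= => [|i x iS]; last exact: (subsetP (sFD i iS)).
rewrite -sum1_card; apply: leq_sum => x _; rewrite sum1_card.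
apply/card_le1_eqP => i j /andP[iS xi] /andP[jS xj].
exact: (disjF _ _ x).
Qed.

Lemma subset_of_card (T : finType) (A : {set T}) m :
  m <= #|A| -> exists2 I : {set T}, I \subset A & #|I| = m.
Proof.
rewrite -bin_gt0 -(cards_draws A m) card_gt0 => /set0Pn[I].
by rewrite inE => /andP[sI /eqP cI]; exists I.
Qed.

Lemma eq_pair (S T : Type) (p q : S * T) : p.1 = q.1 -> p.2 = q.2 -> p = q.
Proof. by case: p q => [a b] [c d] /= -> ->. Qed.

Section PairSystem.
Variable T : finType.
Implicit Types (A B I J U V : {set T}) (F : {set T} -> {set T} -> bool) (e : nat).

(** The pairs [(X :\: X', X' :\: X)] for the codewords [X'] at minimum distance
from a fixed codeword [X], with [U = X] and [V = ~: X]. Stating their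
properties abstractly makes the symmetry between [U] and [V] available. *)
Record pair_system e U V F : Prop := PairSystem {
  ps_size : forall A B, F A B ->
    [/\ A \subset U, B \subset V, #|A| = e.*2.+1 & #|B| = e.*2.+1];
  ps_cover : forall I J, I \subset U -> J \subset V -> #|I| = e.+1 -> #|J| = e.+1 ->
    exists A B, [/\ F A B, I \subset A & J \subset B];
  ps_sep : forall A B A' B', F A B -> F A' B' ->
    e.*2.+1 < #|A :&: A'| + #|B :&: B'| -> A = A' /\ B = B' }.

Lemma pair_system_sym e U V F :
  pair_system e U V F -> pair_system e V U (fun A B => F B A).
Proof.
case=> Hs Hc Hd; split.
- by move=> A B /Hs[].
- by move=> I J sI sJ cI cJ; have [A [B []]] := Hc J I sJ sI cJ cI; exists B, A.
- by move=> A B A' B' FA FA'; rewrite addnC => /(Hd _ _ _ _ FA FA')[].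
Qed.

Lemma pair_eq e U V F (I J A B A' B' : {set T}) :
  pair_system e U V F -> F A B -> F A' B' ->
  I \subset A -> I \subset A' -> J \subset B -> J \subset B' ->
  e.*2.+1 < #|I| + #|J| -> A = A' /\ B = B'.
Proof.
move=> psF FA FA' IA IA' JB JB' lt; apply: (ps_sep psF) => //.
by apply: (leq_trans lt); rewrite leq_add // subset_leq_card // subsetI ?IA ?JB.
Qed.

(** Fix [I] in [U] with [e+1] points and [J] in [V] with [e] points. For each
[y] in [V :\: J] there is one pair [(A, B)] above [(I, y |: J)]. The sets [B
:\: J] partition [V :\: J] into [s] blocks of size [e+1]. For two different
pairs the sets [B] share at least [e] points, hence the sets [A] share
nothing but [I]; so the [s] sets [A :\: I], of size [e], are disjoint in [U
:\: I]. *)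
Lemma pair_system_blocks e U V F :
  pair_system e U V F -> e.+1 <= #|U| -> e <= #|V| ->
  exists s, #|V| = e + s * e.+1 /\ s * e + e.+1 <= #|U|.
Proof.
move=> psF leU leV.
have [I sIU cI] := subset_of_card leU; have [J sJV cJ] := subset_of_card leV.
have cover y : exists c : {set T} * {set T}, y \in V :\: J ->
    [/\ F c.1 c.2, I \subset c.1 & y |: J \subset c.2].
  case: (boolP (y \in V :\: J)) => [|_]; last by exists (set0, set0).
  rewrite inE => /andP[yJ yV].
  have [|||A [B H]] := ps_cover psF sIU (J := y |: J).
  - by rewrite subUset sub1set yV.
  - by [].
  - by rewrite cardsU1 yJ cJ.
  by exists (A, B).
have [c cP] := fin_all_exists cover.
pose S := c @: (V :\: J); exists #|S|.
have yc y : y \in V :\: J -> y \in (c y).2.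
  by move=> /cP[_ _]; rewrite subUset sub1set => /andP[].
have fiber j : j \in S -> \sum_(y in V :\: J | c y == j) 1 = e.+1.
  case/imsetP=> y0 y0V ->; have [F0 I0 J0] := cP _ y0V.
  have [_ sB _ cB] := ps_size psF F0; have [_ sJ] := (subUsetP J0).
  rewrite sum1_card -[RHS](_ : #|(c y0).2 :\: J| = _); last first.
    by rewrite cardsD (setIidPr sJ) cB cJ -addnn -addnS addKn.
  apply: eq_card => y; rewrite [in LHS]unfold_in; apply/andP/setDP.
    by case=> yV /eqP E; split; [rewrite -E yc|move: yV; rewrite inE => /andP[]].
  case=> yB yJ; have yV : y \in V :\: J by rewrite inE yJ (subsetP sB).
  split=> //; apply/eqP; have [Fy Iy Jy] := cP _ yV.
  have [| |EA EB] := pair_eq psF Fy F0 Iy I0 Jy (_ : y |: J \subset (c y0).2).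
  - by rewrite subUset sub1set yB.
  - by rewrite cI cardsU1 yJ cJ; exact: double_ltn.
  exact: eq_pair.
split.
  have <- : #|V :\: J| = #|S| * e.+1.
    by rewrite -sum1_card (partition_big_imset c) /= (eq_bigr _ fiber) sum_nat_const.
  by rewrite cardsD (setIidPr sJV) cJ subnKC.
have -> : #|S| * e = \sum_(j in S) #|j.1 :\: I|.
  rewrite -sum_nat_const; apply: eq_bigr => j /imsetP[y yV ->].
  have [Fy Iy _] := cP _ yV; have [_ _ cA _] := ps_size psF Fy.
  by rewrite cardsD (setIidPr Iy) cA cI double_subn.
rewrite -(subnK leU) leq_add2r.
have <- : #|U :\: I| = #|U| - e.+1 by rewrite cardsD (setIidPr sIU) cI.
apply: sum_card_disjoint => [_ /imsetP[y yV ->]|].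
  have [Fy _ _] := cP _ yV; have [sA _ _ _] := ps_size psF Fy.
  exact: setSD.
move=> _ _ x /imsetP[y yV ->] /imsetP[y' yV' ->] /setDP[xA xI] /setDP[xA' _].
have [Fy Iy Jy] := cP _ yV; have [Fy' Iy' Jy'] := cP _ yV'.
have [_ Jc] := subUsetP Jy; have [_ Jc'] := subUsetP Jy'.
have [| | |EA EB] := pair_eq psF Fy Fy' (_ : x |: I \subset _) _ Jc Jc'.
- by rewrite subUset sub1set xA.
- by rewrite subUset sub1set xA'.
- by rewrite cardsU1 xI cI cJ add1n addSnnS double_ltn.
exact: eq_pair.
Qed.

(** For [x] outside [A0] and [y] outside [B0], where [(A0, B0)] is the pair
above [(I, J)]: the [(e+2)]-sets [x |: I] and [y |: J] fit in a single pair
[(A, B)] apart from one point [z] of [J]. *)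
Definition nearly_covered F I J x y :=
  [exists A : {set T}, exists B : {set T}, exists z in J,
    [&& F A B, I \subset A, y |: (J :\ z) \subset B & x \in A]].

Lemma nearly_coveredP F I J x y :
  reflect (exists A B z, [/\ z \in J, F A B, I \subset A, y |: (J :\ z) \subset B & x \in A])
          (nearly_covered F I J x y).
Proof.
apply: (iffP existsP) => [[A /existsP[B /exists_inP[z zJ /and4P[? ? ? ?]]]]|].
  by exists A, B, z.
case=> A [B [z [zJ FA IA JB xA]]]; exists A; apply/existsP; exists B.
by apply/exists_inP; exists z => //; apply/and4P.
Qed.

(** Each [z] in [J] gives a pair above [(I, y |: (J :\ z))]. Two such pairs
share [I] on the first side and at least [e] points on the second, so their
first members meet only in [I]; for the same reason they avoid [A0] outside
[I]. This makes [e+1] disjoint sets of [e] admissible points [x]. *)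
Lemma card_nearly_covered e U V F A0 B0 I J y :
  pair_system e U V F -> F A0 B0 -> I \subset A0 -> J \subset B0 ->
  #|I| = e.+1 -> #|J| = e.+1 -> y \in V :\: B0 ->
  e.+1 * e <= #|[set x in U :\: A0 | nearly_covered F I J x y]|.
Proof.
move=> psF F0 I0 J0 cI cJ /setDP[yV yB0].
have [sA0 sB0 _ _] := ps_size psF F0.
have yJ : y \notin J by apply: contra yB0; apply: (subsetP J0).
have cJz z : z \in J -> #|J :\ z| = e by move=> zJ; move: cJ; rewrite (cardsD1 z) zJ => -[].
have yJz z : y \notin J :\ z by rewrite !inE (negPf yJ) andbF.
have cover z : exists c : {set T} * {set T}, z \in J ->
    [/\ F c.1 c.2, I \subset c.1 & y |: (J :\ z) \subset c.2].
  case: (boolP (z \in J)) => [zJ|_]; last by exists (set0, set0).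
  have [|||A [B H]] := ps_cover psF (subset_trans I0 sA0) (J := y |: (J :\ z)).
  - rewrite subUset sub1set yV; apply: subset_trans (subsetDl _ _) _.
    exact: subset_trans J0 sB0.
  - by [].
  - by rewrite cardsU1 yJz cJz.
  by exists (A, B).
have [c cP] := fin_all_exists cover.
have -> : e.+1 * e = \sum_(z in J) #|(c z).1 :\: I|.
  rewrite -cJ -sum_nat_const; apply: eq_bigr => z zJ.
  have [Fz Iz _] := cP _ zJ; have [_ _ cA _] := ps_size psF Fz.
  by rewrite cardsD (setIidPr Iz) cA cI double_subn.
have not_both A B : F A B -> I \subset A -> J \subset B -> y \notin B.
  move=> FA IA JB; have [|_ ->] := pair_eq psF FA F0 IA I0 JB J0; last by [].
  by rewrite cI cJ double_ltn.
apply: sum_card_disjoint => [z zJ|z z' x zJ z'J /setDP[xA xI] /setDP[xA' _]].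
  have [Fz Iz Jz] := cP _ zJ; have [yB sJB] := subUsetP Jz.
  have [sA _ _ _] := ps_size psF Fz.
  apply/subsetP => x /setDP[xA xI]; rewrite !inE (subsetP sA) // andbT.
  apply/andP; split; last by apply/nearly_coveredP; exists (c z).1, (c z).2, z.
  apply: contra yB0 => xA0.
  have [| | | |_ <-] := pair_eq psF Fz F0 (_ : x |: I \subset _) _ sJB _.
  - by rewrite subUset sub1set xA.
  - by rewrite subUset sub1set xA0.
  - exact: subset_trans (subsetDl _ _) J0.
  - by rewrite cardsU1 xI cI cJz // add1n addSnnS double_ltn.
  by rewrite -sub1set.
apply/eqP; apply: contraT => neq_z.
have [Fz Iz Jz] := cP _ zJ; have [Fz' Iz' Jz'] := cP _ z'J.
have [yB sJB] := subUsetP Jz; have [yB' sJB'] := subUsetP Jz'.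
have [| | | | |EA EB] := pair_eq psF Fz Fz' (_ : x |: I \subset _) _ (_ : y |: (J :\ z :\ z') \subset _) _.
- by rewrite subUset sub1set xA.
- by rewrite subUset sub1set xA'.
- by rewrite subUset yB (subset_trans (subsetDl _ _)).
- by rewrite subUset yB' (subset_trans _ sJB') // setSD // subsetDl.
- rewrite !cardsU1 xI cI !inE (negPf yJ) !andbF /=.
  have cJzz : #|J :\ z :\ z'|.+1 = e.
    by rewrite -(cJz z zJ) (cardsD1 z' (J :\ z)) !inE eq_sym neq_z z'J.
  by rewrite !add1n addSnnS cJzz double_ltn.
have : y \notin (c z).2.
  apply: (not_both (c z).1) => //; apply/subsetP => u uJ.
  case: (altP (u =P z)) => [->|neq_u].
    by rewrite EB (subsetP sJB') // !inE neq_z zJ.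
  by rewrite (subsetP sJB) // !inE neq_u uJ.
by rewrite -sub1set yB.
Qed.

(** Two pairs witnessing both coverings would share [e+1] points on each side,
hence coincide, and the common pair would contain [(I, J)] and the point [y]
outside [B0]. *)
Lemma nearly_covered_disjoint e U V F A0 B0 I J x y :
  pair_system e U V F -> F A0 B0 -> I \subset A0 -> J \subset B0 ->
  #|I| = e.+1 -> #|J| = e.+1 -> x \notin A0 -> y \notin B0 ->
  nearly_covered F I J x y -> ~~ nearly_covered (fun A B => F B A) J I y x.
Proof.
move=> psF F0 I0 J0 cI cJ xA0 yB0.
have yJ : y \notin J by apply: contra yB0; apply: (subsetP J0).
have xI : x \notin I by apply: contra xA0; apply: (subsetP I0).
case/nearly_coveredP=> A [B [z [zJ FA IA JB xA]]].
apply/negP => /nearly_coveredP[B' [A' [z' [z'I FA' JB' IA' yB']]]].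
have [yB sJB] := subUsetP JB; have [xA' sIA'] := subUsetP IA'.
have [| | |EA EB] := pair_eq psF FA FA' (_ : x |: (I :\ z') \subset _) IA' JB _.
- by rewrite subUset sub1set xA (subset_trans (subsetDl _ _)).
- by rewrite subUset sub1set yB' (subset_trans (subsetDl _ _)).
- rewrite !cardsU1 !inE (negPf xI) (negPf yJ) !andbF /=.
  by move: cI cJ; rewrite (cardsD1 z') (cardsD1 z J) z'I zJ => -> ->; apply: double_ltn.
have [| |_ EB0] := pair_eq psF FA F0 IA I0 (_ : J \subset B) J0.
- by rewrite EB.
- by rewrite cI cJ double_ltn.
by move: yB0; rewrite -EB0 -sub1set yB.
Qed.

(** The cells [(x, y)] of the rectangle [(U :\: A0) * (V :\: B0)] that are
nearly covered along the second side number at least [e (e+1)] for each [y],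
those nearly covered along the first side at least [e (e+1)] for each [x],
and no cell is of both kinds. *)
Lemma pair_system_ineq e U V F A0 B0 :
  pair_system e U V F -> F A0 B0 ->
  e.+1 * e * (#|U :\: A0| + #|V :\: B0|) <= #|U :\: A0| * #|V :\: B0|.
Proof.
move=> psF F0; have [_ _ cA0 cB0] := ps_size psF F0.
have [I I0 cI] : exists2 I : {set T}, I \subset A0 & #|I| = e.+1.
  by apply: subset_of_card; rewrite cA0 ltnS -addnn leq_addr.
have [J J0 cJ] : exists2 J : {set T}, J \subset B0 & #|J| = e.+1.
  by apply: subset_of_card; rewrite cB0 ltnS -addnn leq_addr.
pose P1 x y := nearly_covered F I J x y.
pose P2 x y := nearly_covered (fun A B => F B A) J I y x.
set D := U :\: A0; set E := V :\: B0.
have count (S : {set T}) (P : pred T) : #|[set x in S | P x]| = \sum_(x in S) P x.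
  rewrite -sum1_card (eq_bigl (fun x => (x \in S) && P x)) => [|x]; last by rewrite inE.
  by rewrite big_mkcondr /=; apply: eq_bigr => x _; case: (P x).
apply: (@leq_trans (\sum_(y in E) \sum_(x in D) (P1 x y + P2 x y))).
  under [leqRHS]eq_bigr => y _ do rewrite big_split /=.
  rewrite big_split /= [X in _ <= _ + X]exchange_big /= mulnDr addnC leq_add //.
    rewrite mulnC -sum_nat_const; apply: leq_sum => y yE; rewrite -count.
    exact: (card_nearly_covered psF F0).
  rewrite mulnC -sum_nat_const; apply: leq_sum => x xD; rewrite -count.
  exact: (card_nearly_covered (pair_system_sym psF) F0).
rewrite mulnC -sum_nat_const; apply: leq_sum => y /setDP[_ yB0].
rewrite -sum1_card; apply: leq_sum => x /setDP[_ xA0].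
case: (boolP (P1 x y)) => [H|_]; last exact: leq_b1.
by rewrite /P2 (negPf (nearly_covered_disjoint psF F0 I0 J0 cI cJ xA0 yB0 H)).
Qed.

End PairSystem.

(** * Perfect codes *)

Section Tiling.
Variable n : nat.
Implicit Types (X Y A B : {set 'I_n}) (C : {set {set 'I_n}}).

(** [perfect_code] restated point by point, the form in which the covering and
the disjointness of the balls are used. *)
Record tiling w e C : Prop := Tiling {
  tiling_card : forall X, X \in C -> #|X| = w;
  tiling_cover : forall Y, #|Y| = w -> exists2 X, X \in C & jdist X Y <= e;
  tiling_inj : forall X X' Y, X \in C -> X' \in C -> #|Y| = w ->
     jdist X Y <= e -> jdist X' Y <= e -> X = X' }.

Lemma jdistC X Y : #|X| = #|Y| -> jdist X Y = jdist Y X.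
Proof. by move=> E; rewrite /jdist; move: (cardsID X Y) (cardsID Y X); rewrite setIC; lia. Qed.

Lemma perfect_code_tiling w e C : perfect_code w e C -> tiling w e C.
Proof.
case=> sC /and3P[/eqP cov triv _] inj.
have cC X : X \in C -> #|X| = w by move/(subsetP sC); rewrite inE => /eqP.
have inball X Y : X \in C -> #|Y| = w -> (Y \in jball w e X) = (jdist X Y <= e).
  by move=> XC cY; rewrite !inE cY eqxx.
split=> // [Y cY|X X' Y XC X'C cY dX dX'].
  have : Y \in cover [set jball w e X | X in C] by rewrite cov inE cY.
  rewrite /cover => /bigcupP[_ /imsetP[X XC ->]].
  by rewrite inball // => ?; exists X.
apply: inj => //; apply/eqP; apply: contraT => neq.
have /(_ neq) := trivIsetP triv _ _ (imset_f _ XC) (imset_f _ X'C).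
by move/disjoint_setI0/setP/(_ Y); rewrite inE !inball // dX dX' in_set0.
Qed.

Lemma jdist_compl X Y : jdist (~: X) (~: Y) = jdist Y X.
Proof. by rewrite /jdist setDE setCK setIC -setDE. Qed.

Lemma card_compl X w : #|X| = w -> #|~: X| = n - w.
Proof. by move=> <-; rewrite cardsCs setCK card_ord. Qed.

Lemma tiling_compl w e C : w <= n -> tiling w e C -> tiling (n - w) e (@setC _ @: C).
Proof.
move=> le_wn [cC cov inj].
have cK Y : #|Y| = n - w -> #|~: Y| = w by move/card_compl->; rewrite subKn.
have dC X Y : X \in C -> #|Y| = n - w -> jdist (~: X) Y = jdist X (~: Y).
  by move=> XC cY; rewrite -{1}[Y]setCK jdist_compl jdistC // cK // cC.
split=> [_ /imsetP[X XC ->]|Y cY|_ _ Y /imsetP[X XC ->] /imsetP[X' X'C ->] cY].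
- by rewrite (card_compl (cC _ XC)).
- have [X XC dX] := cov _ (cK _ cY); exists (~: X); first exact: imset_f.
  by rewrite dC.
- by rewrite !dC // => dX dX'; rewrite (inj X X' (~: Y)) // cK.
Qed.

(** Two closer codewords would have a common point halfway in their balls. *)
Lemma tiling_far w e C X X' : tiling w e C ->
  X \in C -> X' \in C -> X != X' -> e.*2 < jdist X X'.
Proof.
move=> [cC _ inj] XC X'C; rewrite ltnNge; apply: contra => le_d.
have cXX' : #|X' :\: X| = #|X :\: X'| by apply: jdistC; rewrite !cC.
have le_half : (jdist X X')./2 <= #|X :\: X'| by exact: half_leq_self.
have [A sA cA] := subset_of_card le_half.
have [B sB cB] : exists2 B : {set 'I_n}, B \subset X' :\: X & #|B| = (jdist X X')./2.
  by apply: subset_of_card; rewrite cXX'.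
have [sAX dA] := subsetDP sA.
set Y := X :\: A :|: B.
have dXY : X :\: Y = A.
  apply/setP => x; rewrite !inE.
  have /implyP := subsetP sA x; have /implyP := subsetP sB x; rewrite !inE.
  by case: (x \in A); case: (x \in B); case: (x \in X); case: (x \in X').
have dX'Y : X' :\: Y = (X' :\: X) :\: B.
  apply/setP => x; rewrite !inE.
  have /implyP := subsetP sA x; have /implyP := subsetP sB x; rewrite !inE.
  by case: (x \in A); case: (x \in B); case: (x \in X); case: (x \in X').
have dYX : Y :\: X = B.
  apply/setP => x; rewrite !inE.
  have /implyP := subsetP sA x; have /implyP := subsetP sB x; rewrite !inE.
  by case: (x \in A); case: (x \in B); case: (x \in X); case: (x \in X').
have cY : #|Y| = w.
  by rewrite -(cC _ XC) -(cardsID X Y) -(cardsID Y X) setIC dXY dYX cA cB.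
have le_half_e : (jdist X X')./2 <= e by rewrite leq_half_double; apply: leqW.
apply/eqP; apply: (inj _ _ Y) => //; first by rewrite /jdist dXY cA.
rewrite /jdist dX'Y cardsD (setIidPr sB) cXX' cB -/(jdist X X').
exact: subn_half_leq.
Qed.

(** The second codeword is written as an exchange performed on [X], which makes
a pair determine it. *)
Definition far_pair e C X A B :=
  [&& A \subset X, B \subset ~: X, #|A| == e.*2.+1, #|B| == e.*2.+1
    & (X :\: A) :|: B \in C].

Lemma exchangeK X A B : A \subset X -> B \subset ~: X ->
  X :\: (X :\: A :|: B) = A /\ (X :\: A :|: B) :\: X = B.
Proof.
move=> sA sB; split; apply/setP => x; rewrite !inE;
have /implyP := subsetP sA x; have /implyP := subsetP sB x; rewrite !inE;
by case: (x \in A); case: (x \in B); case: (x \in X).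
Qed.

Lemma card_exchange X A B : A \subset X -> B \subset ~: X -> #|A| = #|B| ->
  #|X :\: A :|: B| = #|X|.
Proof.
move=> sA sB cAB; have [E1 E2] := exchangeK sA sB.
by rewrite -(cardsID X) E2 -cAB -[in RHS](cardsID (X :\: A :|: B)) E1 setIC.
Qed.

Lemma exchange_diff X Y : X :\: (X :\: Y) :|: (Y :\: X) = Y.
Proof. by apply/setP => x; rewrite !inE; case: (x \in X); case: (x \in Y). Qed.

(** The word [X :\: I :|: J] is at distance [e+1] from [X], so it is covered by
a codeword [X'] different from [X]; as [X'] is at distance at least [2e+1]
from [X] and at most [e] from that word, the exchange from [X] to [X'] has
size exactly [2e+1] and contains [I] and [J]. Separation is the minimum
distance between two codewords of this kind. *)
Lemma tiling_pair_system w e C X : tiling w e C -> X \in C ->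
  pair_system e X (~: X) (far_pair e C X).
Proof.
move=> tC XC; have cX := tiling_card tC XC; split.
- by move=> A B /and5P[sA sB /eqP cA /eqP cB _].
- move=> I J sI sJ cI cJ; set Y := X :\: I :|: J.
  have [dXY dYX] := exchangeK sI sJ.
  have cY : #|Y| = w by rewrite card_exchange // cI cJ.
  have [X' X'C dX'] := tiling_cover tC cY; have cX' := tiling_card tC X'C.
  have neqX : X != X'.
    by apply/eqP => E; move: dX'; rewrite -E /jdist dXY cI ltnn.
  have far := tiling_far tC XC X'C neqX.
  have dYX' : #|Y :\: X'| <= e by rewrite -[#|_|]/(jdist Y X') jdistC // cY.
  have cXX' : #|X' :\: X| = #|X :\: X'| by apply: jdistC; rewrite cX.
  (* Each of the two exchange sets splits into a part forced by I or J and a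
     part inside a difference with [Y], which has at most [e] elements. *)
  have splitA : #|X :\: X'| <= #|I :\: X'| + e.
    apply: leq_trans (leq_add (leqnn _) dYX').
    apply: leq_trans (leq_card_setU _ _); apply: subset_leq_card.
    by apply/subsetP => x; rewrite !inE; case: (x \in X'); case: (x \in I); case: (x \in X).
  have splitB : #|X' :\: X| <= #|J :&: X'| + e.
    apply: leq_trans (leq_add (leqnn _) dX').
    apply: leq_trans (leq_card_setU _ _); apply: subset_leq_card.
    apply/subsetP => x; have /implyP := subsetP sI x; rewrite !inE.
    by case: (x \in X'); case: (x \in I); case: (x \in J); case: (x \in X).
  have sIX' : I :\: X' = I.
    apply/eqP; rewrite eqEcard subsetDl cI -(leq_add2r e) addSn addnn.
    exact: leq_trans far splitA.
  have sJX' : J :&: X' = J.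
    apply/eqP; rewrite eqEcard subsetIl cJ -(leq_add2r e) addSn addnn.
    by apply: leq_trans splitB; rewrite cXX'.
  have cA : #|X :\: X'| = e.*2.+1.
    by apply/eqP; rewrite eqn_leq far andbT (leq_trans splitA) // sIX' cI addSn addnn.
  exists (X :\: X'), (X' :\: X); split.
  + rewrite /far_pair subsetDl cXX' cA !eqxx exchange_diff X'C andbT /=.
    by rewrite setDE subsetIr.
  + by rewrite subsetD sI; apply/setDidPl.
  + by rewrite setDE subsetI sJ -sJX' subsetIr.
- move=> A B A' B' /and5P[sA sB /eqP cA /eqP cB Y1] /and5P[sA' sB' /eqP cA' /eqP cB' Y2] lt.
  have [E1 E2] := exchangeK sA sB; have [E3 E4] := exchangeK sA' sB'.
  suff E : X :\: A :|: B = X :\: A' :|: B'.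
    by split; [rewrite -E1 E E3|rewrite -E2 E E4].
  apply/eqP; apply: contraT => /(tiling_far tC Y1 Y2) far.
  have : jdist (X :\: A :|: B) (X :\: A' :|: B') <= #|A' :\: A| + #|B :\: B'|.
    apply: leq_trans (leq_card_setU _ _); apply: subset_leq_card.
    apply/subsetP => x; rewrite !inE.
    have /implyP := subsetP sB x; rewrite !inE.
    by case: (x \in X); case: (x \in A); case: (x \in B); case: (x \in A'); case: (x \in B').
  rewrite leqNgt => /negP[]; apply: leq_trans far.
  move: (cardsID A A') (cardsID B' B) lt; rewrite cA' cB setIC.
  move: #|A :&: A'| #|B :&: B'| #|A' :\: A| #|B :\: B'| => a b c d; lia.
Qed.


Lemma card_supersets A w : w <= n ->
  #|[set X : {set 'I_n} | (A \subset X) && (#|X| == w)]| = 'C(n - #|A|, n - w).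
Proof.
move=> le_wn; rewrite -(card_compl (erefl #|A|)) -cards_draws.
rewrite -(card_imset _ (@setC_inj _)); apply: eq_card => Y.
apply/imsetP/idP => [[X] + ->|]; rewrite !inE => /andP[sA /eqP cX].
  by rewrite setCS sA (card_compl cX) eqxx.
exists (~: Y); last by rewrite setCK.
by rewrite inE (card_compl cX) subKn // eqxx andbT -setCS setCK.
Qed.

Lemma tiling_ball_size w e C (Z : {set 'I_n}) : tiling w e C -> w <= n -> e <= w -> #|Z| = w ->
  (\sum_(X : {set 'I_n} | (X \subset setT) && (#|X| == w)) ball_kernel e #|X :\: Z|
   = (ball_size e w (n - w))%:R)%R.
Proof.
move=> tC le_wn le_ew cZ; rewrite -eigen_ball0 // /eigen.
rewrite -(sum_kernel (G := setT) (X := Z)) ?subsetT ?cardsT ?card_ord ?subnKC //.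
apply: eq_bigr => X /andP[_ /eqP cX]; congr (ball_kernel e _).
by apply: jdistC; rewrite cX.
Qed.

(** Apply [kernel_design] to [Phi * 1_C - 1], which the ball kernel annihilates
since every ball contains exactly one codeword. *)
Lemma tiling_design w e C t A : tiling w e C -> w <= n -> e <= w ->
  t <= w -> t <= n - w ->
  (forall j, j < t -> eigen (iter j.+1 nabla (ball_kernel e)) (w - j.+1) (n - w - j.+1) != 0%R) ->
  #|A| <= t -> ball_size e w (n - w) %| 'C(n - #|A|, n - w).
Proof.
move=> tC le_wn le_ew le_tw le_tv Heig cA.
set Phi := ball_size e w (n - w).
pose g (X : {set 'I_n}) : int := (Phi%:R *+ (X \in C) - 1)%R.
have Phi_gt0 : 0 < Phi by rewrite /Phi /ball_size big_ord_recl !bin0.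
have cG : #|[set: 'I_n]| = w + (n - w) by rewrite cardsT card_ord subnKC.
have HK (Z : {set 'I_n}) : Z \subset setT -> #|Z| = w ->
   (\sum_(X : {set 'I_n} | (X \subset setT) && (#|X| == w)) ball_kernel e #|X :\: Z| * g X = 0)%R.
  move=> _ cZ; under eq_bigr => X _ do rewrite mulrBr mulr1.
  rewrite sumrB (tiling_ball_size tC) //.
  have [X0 X0C dX0] := tiling_cover tC cZ; have cX0 := tiling_card tC X0C.
  rewrite (bigD1 X0) /=; last by rewrite subsetT cX0 eqxx.
  rewrite /ball_kernel dX0 X0C mul1r big1 ?addr0 ?subrr // => X /andP[/andP[_ cX] neqX].
  case: (boolP (X \in C)) => XC; last by rewrite mulr0.
  case: (leqP #|X :\: Z| e) => dX; last by rewrite mul0r.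
  by rewrite (tiling_inj tC XC X0C cZ dX dX0) eqxx in neqX.
have Heig' j : j <= t -> eigen (iter j nabla (ball_kernel e)) (w - j) (n - w - j) != 0%R.
  case: j => [_|j]; last exact: Heig.
  by rewrite !subn0 /= eigen_ball0 // pnatr_eq0 -lt0n.
have /eqP := kernel_design cG le_tw le_tv HK Heig' (subsetT A) cA.
rewrite /containing /g.
under eq_bigr => X _ do rewrite mulrnBl.
rewrite sumrB subr_eq0 => /eqP E.
pose N := \sum_(X : {set 'I_n} | (X \subset setT) && (#|X| == w)) (X \in C) * (A \subset X).
suff -> : 'C(n - #|A|, n - w) = Phi * N by apply: dvdn_mulr.
apply/eqP; rewrite -(@eqr_nat int) -(card_supersets A le_wn) natrM.
apply/eqP; transitivity (\sum_(X : {set 'I_n} | (X \subset setT) && (#|X| == w)) (A \subset X)%:R : int)%R.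
  rewrite -sum1_card natr_sum big_mkcond [RHS]big_mkcond /=; apply: eq_bigr => X _.
  by rewrite inE subsetT andbC /=; case: (#|X| == w); case: (A \subset X).
rewrite -E /N; clearbody Phi; rewrite natr_sum big_distrr /=; apply: eq_bigr => X _.
by case: (X \in C); case: (A \subset X); rewrite ?mulr1 ?mulr0.
Qed.

(** If [al > 0], the inequalities from the local structure bring the prime [p]
into play: [p ^ 2] divides the ball size, hence the binomial coefficients
that [tiling_design] provides, against [exists_bin_logn_le1]. *)
Lemma tiling_trivial_params w e C X p : prime p -> p ^ 2 %| e.+1 ->
  tiling w e C -> X \in C -> w <= n - w -> e.*2 < w ->
  w = e.*2.+1 /\ n - w = e.*2.+1.
Proof.
move=> p_pr pe tC XC le_wv lt_ew; set v := n - w in le_wv *.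
have cX := tiling_card tC XC; have cXc : #|~: X| = v := card_compl cX.
have psF := tiling_pair_system tC XC; have psF' := pair_system_sym psF.
have le_wn : w <= n by rewrite -cX -[n in _ <= n]card_ord max_card.
have [s [Ev le_s]] : exists s, v = e + s * e.+1 /\ s * e + e.+1 <= w.
  rewrite -cX -cXc; apply: (pair_system_blocks psF); rewrite ?cX ?cXc.
    by apply: leq_trans lt_ew; rewrite ltnS -addnn leq_addr.
  by apply: leq_trans (leq_trans (ltnW lt_ew) le_wv); rewrite -addnn leq_addr.
have [s' [Ew _]] : exists s, w = e + s * e.+1 /\ s * e + e.+1 <= v.
  rewrite -cX -cXc; apply: (pair_system_blocks psF'); rewrite ?cX ?cXc.
    by apply: leq_trans (leq_trans lt_ew le_wv); rewrite ltnS -addnn leq_addr.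
  by apply: leq_trans (ltnW lt_ew); rewrite -addnn leq_addr.
have [A0 [B0 F0]] : exists A B, far_pair e C X A B.
  have [I sI cI] : exists2 I : {set 'I_n}, I \subset X & #|I| = e.+1.
    by apply: subset_of_card; rewrite cX; apply: leq_trans lt_ew; rewrite ltnS -addnn leq_addr.
  have [J sJ cJ] : exists2 J : {set 'I_n}, J \subset ~: X & #|J| = e.+1.
    by apply: subset_of_card; rewrite cXc; apply: leq_trans (leq_trans lt_ew le_wv); rewrite ltnS -addnn leq_addr.
  by have [A [B [F0 _ _]]] := ps_cover psF sI sJ cI cJ; exists A, B.
have [sA0 sB0 cA0 cB0] := ps_size psF F0.
have := pair_system_ineq psF F0.
rewrite !cardsD (setIidPr sA0) (setIidPr sB0) cX cXc cA0 cB0.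
clear A0 B0 F0 sA0 sB0 cA0 cB0 psF psF'.
have [al Eal] : exists al, w = al + e.*2.+1 by exists (w - e.*2.+1); rewrite subnK.
have [be Ebe] : exists be, v = be + e.*2.+1 by exists (v - e.*2.+1); rewrite subnK // (leq_trans lt_ew).
rewrite Eal Ebe !addnK => harm.
have p_gt1 := prime_gt1 p_pr.
have e_ge3 : 3 <= e.
  rewrite -ltnS -[3.+1]/(2 ^ 2); apply: leq_trans (dvdn_leq (ltn0Sn e) pe).
  by rewrite leq_exp2r.
case: (posnP al) => [al0|al_gt0].
  move: harm; rewrite al0 mul0n !add0n leqn0 !muln_eq0 /= => /orP[/eqP e0|/eqP-> //].
  by rewrite e0 in e_ge3.
exfalso.
have le_ab : al <= be by move: le_wv; rewrite Eal Ebe leq_add2r.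
have ratio : e * be <= e.+1 * al by apply: (block_ratio (s := s)); rewrite -?Eal -?Ebe.
have lt_v : 2 * v < 3 * w by rewrite Eal Ebe; apply: lt_ratio.
have [i [lt_i le_i le1]] := exists_bin_logn_le1 p_pr (leq_ltn_trans (leq0n _) lt_ew) lt_v.
have [A _ cA] : exists2 A : {set 'I_n}, A \subset X & #|A| = i.
  by apply: subset_of_card; rewrite cX.
have: ball_size e w v %| 'C(n - #|A|, v).
  have le_iv : i <= v := leq_trans le_i le_wv.
  have le_ew : e <= w by rewrite Ew leq_addr.
  apply: (tiling_design tC le_wn le_ew le_i le_iv) => [j lt_j|]; last by rewrite cA.
  rewrite gt_eqF //.
  have le_j : 2 * j.+1 <= al + 2 * e.
    by move: lt_i; rewrite Eal => lt_i; apply: double_index_bound lt_j lt_i.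
  have [H1 H2 H3] := radius_bound al_gt0 le_ab ratio harm le_j.
  by apply: eigen_ball_gt0; rewrite -/v ?Eal ?Ebe.
have -> : n - #|A| = w + v - i by rewrite cA subnKC.
have p2Phi : p ^ 2 %| ball_size e w v.
  by apply: dvdn_ball_size => //; rewrite ?Ew ?Ev -addSn -mulSn dvdn_mull.
move=> /(dvdn_trans p2Phi); rewrite pfactor_dvdn //; last first.
  by rewrite bin_gt0 addnC -addnBA // leq_addr.
by rewrite leqNgt ltnS le1.
Qed.

End Tiling.

(** A second codeword makes both [w] and [n - w] exceed [2e]; the case [n - w <
w] is treated through the complementary code. Once [w = n - w = 2e+1], the
minimum distance leaves room only for [X] and its complement. *)
Lemma perfect_code_trivial e p n w (C : {set {set 'I_n}}) :
  prime p -> p ^ 2 %| e.+1 -> w <= n -> perfect_code w e C -> trivial_code w e C.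
Proof.
move=> p_pr pe le_wn /perfect_code_tiling tC.
have [X0 _ cX0] : exists2 X : {set 'I_n}, X \subset setT & #|X| = w.
  by apply: subset_of_card; rewrite cardsT card_ord.
have [X XC _] := tiling_cover tC cX0; have cX := tiling_card tC XC.
case: (eqVneq #|C| 1) => [C1|C_neq1]; first by constructor 2.
have far Y : Y \in C -> X != Y -> e.*2 < #|X :\: Y| := @tiling_far _ _ _ _ X Y tC XC.
have [X' X'C neqX] : exists2 X', X' \in C & X != X'.
  apply/exists_inP; apply: contraR C_neq1 => /exists_inPn H; apply/eqP/eqP/cards1P.
  exists X; apply/setP => Y; rewrite inE; apply/idP/eqP => [/H|->//].
  by rewrite negbK eq_sym => /eqP.
have lt_ew : e.*2 < w by rewrite -cX (leq_trans (far _ X'C neqX)) ?subset_leq_card ?subsetDl.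
have lt_ev : e.*2 < n - w.
  rewrite -(card_compl cX); apply: leq_trans (far _ X'C neqX) _.
  rewrite -[#|_ :\: _|]/(jdist X X') jdistC ?cX ?(tiling_card tC X'C) //.
  by rewrite /jdist setDE subset_leq_card ?subsetIr.
have [Ew Ev] : w = e.*2.+1 /\ n - w = e.*2.+1.
  case: (leqP w (n - w)) => [le_wv|/ltnW le_vw].
    exact: (tiling_trivial_params p_pr pe tC XC).
  have [| |E1 E2] := tiling_trivial_params p_pr pe (tiling_compl le_wn tC) (imset_f _ XC).
  - by rewrite subKn.
  - by [].
  by split=> //; rewrite -E2 subKn.
constructor 3; split; first by rewrite -(subnK le_wn) Ev Ew mul2n addnn.
  by rewrite Ew mul2n addn1.
have only_compl Y : Y \in C -> X != Y -> Y = ~: X.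
  move=> YC neqY; apply/eqP; rewrite eqEcard (card_compl cX) Ev (tiling_card tC YC) Ew leqnn andbT.
  rewrite subsetC; apply/setIidPl; rewrite -setDE; apply/eqP.
  by rewrite eqEcard subsetDl cX Ew far.
exists X; first by rewrite inE cX.
apply/setP => Y; rewrite !inE; apply/idP/orP => [YC|[/eqP->//|/eqP->]].
  by case: (altP (X =P Y)) => [->|/(only_compl _ YC) ->]; [left|right].
by rewrite -(only_compl _ X'C neqX).
Qed.

Theorem corollary3p3 (e : nat) (he : 1 <= e)
    (hp : exists2 p : nat, prime p & p ^ 2 %| e + 1) (n w : nat)
    (hw : 1 <= w <= n - 1) :
  ~ exists C : {set {set 'I_n}}, perfect_code w e C /\ ~ trivial_code w e C.
Proof.
case: hp => p p_pr; rewrite addn1 => pe [C [perfC]]; apply.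
have le_wn : w <= n by case/andP: hw => _ le_w; apply: leq_trans le_w (leq_subr _ _).
exact: (perfect_code_trivial p_pr pe le_wn perfC).
Qed.
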